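(* Let $F$ be a transition formula over $X$. Then for every $t\in\mathbb{N}$, $F^t\models_{\mathbf{LIRR}}F^\star$.
   Context: $X$ is a finite set of symbols, $X'=\{x':x\in X\}$ primed copies. A transition formula is a ground $\sigma^Z_{or}(X\cup X')$-formula, where $\sigma^Z_{or}$ is the ordered-ring signature ($+,\cdot,0,1,=,\le$) plus a unary predicate $\mathit{Int}$. Composition: $F\circ G=\exists X''.\,F[X'\mapsto X'']\land G[X\mapsto X'']$ with fresh $X''$; $F^t=F\circ\dots\circ F$ ($t$ times), $F^0$ being $\bigwedge_{x\in X}x'=x$. $\mathbf{LIRR}$: commutative ring axioms; $\le$ reflexive, transitive, antisymmetric; $x\le y\Rightarrow x+z\le y+z$; $0\le1\land0\ne1$; for each integer $n\ge1$, $\exists x\,(nx=1)$ and $\forall x\,(0\le nx\Rightarrow0\le x)$ ($nx$ meaning $n$-fold sum); $\mathit{Int}(1)$; $\mathit{Int}$ closed under $+$ and additive inverses; for integers $n>0$, $m$: $\forall x(\mathit{Int}(x)\land0\le nx+m\Rightarrow0\le x+\lfloor m/n\rfloor)$. Let $\mathrm{Cn}(F)=\{p\in\mathbb{Q}[X\cup X']:F\models_{\mathbf{LIRR}}0\le p\}$. $(\cdot)'$ is the ring homomorphism $\mathbb{Q}[X]\to\mathbb{Q}[X']$, $x\mapsto x'$. $\mathrm{LinInv}(F)=\{k\in\mathrm{span}_{\mathbb{Q}}(X):F\models_{\mathbf{LIRR}}k'=k\}$, with basis $a_1,\dots,a_n$. Let $D=\{d_x:x\in X\}$, $K=\{k_1,\dots,k_n\}$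 be fresh variables; $\delta:\mathbb{Q}[D]\to\mathbb{Q}[X\cup X']$, $d_x\mapsto x-x'$; $\mathit{inv}:\mathbb{Q}[K]\to\mathbb{Q}[X]$, $k_i\mapsto a_i$; $\delta_{inv}:\mathbb{Q}[D\cup K]\to\mathbb{Q}[X\cup X']$ their common extension (ring homomorphisms). Every $p\in\mathrm{span}_{\mathbb{Q}}(D)+\mathbb{Q}[K]$ is uniquely $p=\pi_D(p)+\pi_K(p)$ with $\pi_D(p)\in\mathrm{span}_{\mathbb{Q}}(D)$, $\pi_K(p)\in\mathbb{Q}[K]$. Let $V\subseteq\mathbb{Q}[K]$, $R\subseteq\mathrm{span}_{\mathbb{Q}}(D)+\mathbb{Q}[K]$ be the finite sets produced by the paper's algorithm, which satisfy $\mathbb{Q}[K]\cdot V+\mathrm{cone}(R)=\delta_{inv}^{-1}(\mathrm{Cn}(F))\cap(\mathrm{span}_{\mathbb{Q}}(D)+\mathbb{Q}[K])$ ($\mathrm{cone}$: non-negative rational combinations) and $F\models_{\mathbf{LIRR}}\delta_{inv}(v)=0$ for all $v\in V$. For a fresh constant $t$, $\mathit{cf}(p)=\delta(\pi_D(p))+t\cdot\mathit{inv}(\pi_K(p))$, $\exp(F,t)=\bigwedge_{v\in V}0=\mathit{cf}(v)\land\bigwedge_{r\in R}0\le\mathit{cf}(r)$, and $F^\star=\exists t.\,\mathit{Int}(t)\land t\ge0\land\exp(F,t)$. *)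

(* Defs.v *)
From HB Require Import structures.
From mathcomp Require Import all_boot all_order all_algebra.
From mathcomp Require Import mpoly.

Set Implicit Arguments.
Unset Strict Implicit.
Unset Printing Implicit Defensive.

Import Order.TTheory GRing.Theory Num.Theory.
Local Open Scope ring_scope.

Definition case_split (T : Type) (m n : nat) (f : 'I_m -> T) (g : 'I_n -> T)
    (i : 'I_(m + n)) : T :=
  match split i with inl j => f j | inr k => g k end.

(* [formula n] is the type of closed first-order formulas over the ordered-ring
   signature with Int and n extra constant symbols, indexed by 'I_n. A
   quantifier binds the constant ord0 of its body. *)
Inductive term (n : nat) : Type :=
| TCst of 'I_n
| TZero
| TOne
| TAdd of term n & term n
| TMul of term n & term n.
Arguments TZero {n}.
Arguments TOne {n}.

Inductive formula (n : nat) : Type :=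
| FTrue
| FEq of term n & term n
| FLe of term n & term n
| FInt of term n
| FNot of formula n
| FAnd of formula n & formula n
| FOr of formula n & formula n
| FEx of formula n.+1
| FAll of formula n.+1.
Arguments FTrue {n}.

Fixpoint ground (n : nat) (F : formula n) : Prop :=
  match F with
  | FTrue | FEq _ _ | FLe _ _ | FInt _ => True
  | FNot G => ground G
  | FAnd G H | FOr G H => ground G /\ ground H
  | FEx _ | FAll _ => False
  end.

Fixpoint trename (n m : nat) (f : 'I_n -> 'I_m) (s : term n) : term m :=
  match s with
  | TCst i => TCst (f i)
  | TZero => TZero
  | TOne => TOne
  | TAdd u v => TAdd (trename f u) (trename f v)
  | TMul u v => TMul (trename f u) (trename f v)
  end.

Definition under_binder (n m : nat) (f : 'I_n -> 'I_m) (i : 'I_n.+1) : 'I_m.+1 :=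
  if unlift ord0 i is Some j then lift ord0 (f j) else ord0.

Fixpoint frename (n m : nat) (f : 'I_n -> 'I_m) (F : formula n) : formula m :=
  match F with
  | FTrue => FTrue
  | FEq s u => FEq (trename f s) (trename f u)
  | FLe s u => FLe (trename f s) (trename f u)
  | FInt s => FInt (trename f s)
  | FNot G => FNot (frename f G)
  | FAnd G H => FAnd (frename f G) (frename f H)
  | FOr G H => FOr (frename f G) (frename f H)
  | FEx G => FEx (frename (under_binder f) G)
  | FAll G => FAll (frename (under_binder f) G)
  end.

Definition FAnds (n : nat) (Fs : seq (formula n)) : formula n :=
  foldr (@FAnd n) FTrue Fs.

Fixpoint FExs (m n : nat) : formula (m + n) -> formula n :=
  match m return formula (m + n) -> formula n with
  | 0 => fun F => F
  | m'.+1 => fun F => @FExs m' n (FEx F)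
  end.

(* The carrier's comNzRingType structure accounts for the commutative ring
   axioms and for 0 != 1; classically its choice operator is no restriction. *)
Record structure := Structure {
  carrier :> comNzRingType;
  sle : carrier -> carrier -> Prop;
  sint : carrier -> Prop
}.

Fixpoint teval (M : structure) (n : nat) (e : 'I_n -> M) (s : term n) : M :=
  match s with
  | TCst i => e i
  | TZero => 0
  | TOne => 1
  | TAdd u v => teval e u + teval e v
  | TMul u v => teval e u * teval e v
  end.

Definition econs (T : Type) (n : nat) (x : T) (e : 'I_n -> T) (i : 'I_n.+1) : T :=
  if unlift ord0 i is Some j then e j else x.

Fixpoint sat (M : structure) (n : nat) (e : 'I_n -> M) (F : formula n) : Prop :=
  match F with
  | FTrue => True
  | FEq s u => teval e s = teval e u
  | FLe s u => sle (teval e s) (teval e u)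
  | FInt s => sint (teval e s)
  | FNot G => ~ sat e G
  | FAnd G H => sat e G /\ sat e H
  | FOr G H => sat e G \/ sat e H
  | FEx G => exists x : M, sat (econs x e) G
  | FAll G => forall x : M, sat (econs x e) G
  end.

Record LIRR (M : structure) : Prop := {
  lirr_refl : forall x : M, sle x x;
  lirr_trans : forall x y z : M, sle x y -> sle y z -> sle x z;
  lirr_antisym : forall x y : M, sle x y -> sle y x -> x = y;
  lirr_add : forall x y z : M, sle x y -> sle (x + z) (y + z);
  lirr_01 : @sle M 0 1;
  lirr_div : forall n : nat, (0 < n)%N -> exists x : M, x *+ n = 1;
  lirr_unperf : forall n : nat, (0 < n)%N ->
    forall x : M, sle 0 (x *+ n) -> sle 0 x;
  lirr_int1 : @sint M 1;
  lirr_intD : forall x y : M, sint x -> sint y -> sint (x + y);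
  lirr_intN : forall x : M, sint x -> sint (- x);
  lirr_cut : forall (n : nat) (m : int), (0 < n)%N ->
    forall x : M, sint x -> sle 0 (x *+ n + m%:~R) ->
      sle 0 (x + (m %/ n%:Z)%Z%:~R)
}.

Definition entails (n : nat) (F G : formula n) : Prop :=
  forall M : structure, LIRR M ->
  forall e : 'I_n -> M, sat e F -> sat e G.

(* An atom between rational polynomials abbreviates the atom of the signature
   obtained by multiplying q - p by a common denominator of its coefficients
   and moving the monomials with negative coefficient to the other side. *)
Definition cleared_coef (n : nat) (p : {mpoly rat[n]}) (m : 'X_{1..n}) : int :=
  numq ((\prod_(m' <- msupp p) denq p@_m')%:~R * p@_m).

Definition tmonom (n : nat) (m : 'X_{1..n}) : term n :=
  foldr (@TMul n) TOne [seq iter (m i) (TMul (TCst i)) TOne | i <- enum 'I_n].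

Definition signed_part (sg : int) (n : nat) (p : {mpoly rat[n]}) : term n :=
  foldr (@TAdd n) TZero
    [seq iter (absz (Num.max 0 (sg * cleared_coef p m))) (TAdd (tmonom m)) TZero
    | m <- msupp p].

Definition FLep (n : nat) (p q : {mpoly rat[n]}) : formula n :=
  FLe (signed_part (-1) (q - p)) (signed_part 1 (q - p)).

Definition FEqp (n : nat) (p q : {mpoly rat[n]}) : formula n :=
  FEq (signed_part (-1) (q - p)) (signed_part 1 (q - p)).

Definition subst (n k : nat) (h : 'I_n -> {mpoly rat[k]}) (p : {mpoly rat[n]}) :
  {mpoly rat[k]} := p \mPo [tuple h i | i < n].

Section Transition.

(* X is 'I_N; in 'I_(N + N) the symbol x is lshift N x and x' is rshift N x. *)
Variable N : nat.

Definition fcomp (F G : formula (N + N)) : formula (N + N) :=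
  FExs (m := N)
    (FAnd (frename (case_split (fun x => rshift N (lshift N x))
                               (fun x => lshift (N + N) x)) F)
          (frename (case_split (fun x => lshift (N + N) x)
                               (fun x => rshift N (rshift N x))) G)).

Definition fid : formula (N + N) :=
  FAnds [seq FEq (TCst (rshift N x)) (TCst (lshift N x)) | x <- enum 'I_N].

Definition fpow (F : formula (N + N)) (t : nat) : formula (N + N) :=
  iterop t fcomp F fid.

Definition Cn (F : formula (N + N)) (p : {mpoly rat[N + N]}) : Prop :=
  entails F (FLep 0 p).

Definition unprimed (p : {mpoly rat[N]}) : {mpoly rat[N + N]} :=
  subst (fun x => 'X_(lshift N x)) p.

Definition primed (p : {mpoly rat[N]}) : {mpoly rat[N + N]} :=
  subst (fun x => 'X_(rshift N x)) p.

Definition linear_form (p : {mpoly rat[N]}) : Prop :=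
  exists c : 'I_N -> rat, p = \sum_(x < N) c x *: 'X_x.

Definition LinInv (F : formula (N + N)) (k : {mpoly rat[N]}) : Prop :=
  linear_form k /\ entails F (FEqp (primed k) (unprimed k)).

Definition is_basis (n : nat) (S : {mpoly rat[N]} -> Prop)
    (a : 'I_n -> {mpoly rat[N]}) : Prop :=
  [/\ forall i, S (a i),
      forall k, S k -> exists c : 'I_n -> rat, k = \sum_(i < n) c i *: a i &
      forall c : 'I_n -> rat,
        \sum_(i < n) c i *: a i = 0 -> forall i, c i = 0].

(* K is 'I_n and D is 'I_N; in 'I_(N + n) the symbol d_x is lshift n x and k_i
   is rshift N i. *)
Variable n : nat.

Definition inD (p : {mpoly rat[N]}) : {mpoly rat[N + n]} :=
  subst (fun x => 'X_(lshift n x)) p.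

Definition inK (p : {mpoly rat[n]}) : {mpoly rat[N + n]} :=
  subst (fun i => 'X_(rshift N i)) p.

Definition spanD_plus_QK (p : {mpoly rat[N + n]}) : Prop :=
  exists (d : {mpoly rat[N]}) (q : {mpoly rat[n]}),
    linear_form d /\ p = inD d + inK q.

(* On span(D) + Q[K] these are the two components (piDK_unique below). *)
Definition piD (p : {mpoly rat[N + n]}) : {mpoly rat[N]} :=
  \sum_(x < N) p@_(U_(lshift n x)) *: 'X_x.

Definition piK (p : {mpoly rat[N + n]}) : {mpoly rat[n]} :=
  subst (case_split (fun=> 0) (fun i => 'X_i)) p.

Definition delta (p : {mpoly rat[N]}) : {mpoly rat[N + N]} :=
  subst (fun x => 'X_(lshift N x) - 'X_(rshift N x)) p.

Variable a : 'I_n -> {mpoly rat[N]}.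

Definition inv (p : {mpoly rat[n]}) : {mpoly rat[N]} := subst a p.

Definition delta_inv (p : {mpoly rat[N + n]}) : {mpoly rat[N + N]} :=
  subst (case_split (fun x => 'X_(lshift N x) - 'X_(rshift N x))
                    (fun i => unprimed (a i))) p.

Definition ideal_plus_cone (V : seq {mpoly rat[n]}) (R : seq {mpoly rat[N + n]})
    (p : {mpoly rat[N + n]}) : Prop :=
  exists (q : {mpoly rat[n]} -> {mpoly rat[n]}) (c : {mpoly rat[N + n]} -> rat),
    (forall r, r \in R -> 0 <= c r) /\
    p = inK (\sum_(v <- V) q v * v) + \sum_(r <- R) c r *: r.

(* The fresh constant t is the first one of 'I_(1 + (N + N)). *)
Definition tcst : 'I_(1 + (N + N)) := lshift (N + N) ord0.

Definition weaken (p : {mpoly rat[N + N]}) : {mpoly rat[1 + (N + N)]} :=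
  subst (fun i => 'X_(rshift 1 i)) p.

Definition cf (p : {mpoly rat[N + n]}) : {mpoly rat[1 + (N + N)]} :=
  weaken (delta (piD p)) + 'X_tcst * weaken (unprimed (inv (piK p))).

Definition fexp (V : seq {mpoly rat[n]}) (R : seq {mpoly rat[N + n]}) :
    formula (1 + (N + N)) :=
  FAnd (FAnds [seq FEqp 0 (cf (inK v)) | v <- V])
       (FAnds [seq FLep 0 (cf r) | r <- R]).

Definition fstar (V : seq {mpoly rat[n]}) (R : seq {mpoly rat[N + n]}) :
    formula (N + N) :=
  FEx (FAnd (FInt (TCst tcst)) (FAnd (FLe TZero (TCst tcst)) (fexp V R))).

Lemma piDK_unique (d : {mpoly rat[N]}) (q : {mpoly rat[n]}) :
  linear_form d -> piD (inD d + inK q) = d /\ piK (inD d + inK q) = q.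
Proof.
have substU k l (h : 'I_k -> {mpoly rat[l]}) i : subst h 'X_i = h i.
  by rewrite /subst comp_mpolyXU -tnth_nth tnth_mktuple.
have substX k l (h : 'I_k -> {mpoly rat[l]}) m :
    subst h 'X_[m] = \prod_(i < k) h i ^+ m i.
  by rewrite /subst comp_mpolyX; apply: eq_bigr => i _; rewrite tnth_mktuple.
have substZ k l (h : 'I_k -> {mpoly rat[l]}) c p :
    subst h (c *: p) = c *: subst h p by exact: comp_mpolyZ.
have substD k l (h : 'I_k -> {mpoly rat[l]}) p r :
    subst h (p + r) = subst h p + subst h r by exact: comp_mpolyD.
have subst_sum k l (h : 'I_k -> {mpoly rat[l]}) (I : Type) (s : seq I) f :
    subst h (\sum_(i <- s) f i) = \sum_(i <- s) subst h (f i).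
  by rewrite /subst raddf_sum.
case=> c ->.
have -> : inD (\sum_(x < N) c x *: 'X_x) = \sum_(x < N) c x *: 'X_(lshift n x).
  by rewrite /inD subst_sum; apply: eq_bigr => x _; rewrite substZ substU.
have inKE : inK q = \sum_(m <- msupp q) q@_m *: \prod_(i < n) 'X_(rshift N i) ^+ m i.
  rewrite {1}(mpolyE q) /inK subst_sum; apply: eq_bigr => m _.
  by rewrite substZ substX.
split; last first.
  rewrite /piK substD subst_sum big1 ?add0r => [|x _]; last first.
    by rewrite substZ substU /case_split (unsplitK (inl x)) scaler0.
  rewrite inKE subst_sum [RHS]mpolyE; apply: eq_bigr => m _.
  rewrite substZ mpolyXE_id /subst rmorph_prod; congr (_ *: _).
  apply: eq_bigr => i _; rewrite rmorphXn /= -/(subst _ _) substU.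
  by rewrite /case_split (unsplitK (inr i)).
apply: eq_bigr => x _; congr (_ *: _).
rewrite mcoeffD raddf_sum (bigD1 x) //=.
rewrite mcoeffZ mcoeffXU eqxx mulr1 big1 ?addr0 => [|y yx]; last first.
  by rewrite mcoeffZ mcoeffXU eq_lshift (negbTE yx) mulr0.
rewrite inKE raddf_sum big1 ?addr0 // => m _ /=; rewrite mcoeffZ.
have -> : \prod_(i < n) 'X_(rshift N i) ^+ m i =
    'X_[rat, (\sum_(i < n) U_(rshift N i) *+ m i)%MM].
  by rewrite -mprodXE; apply: eq_bigr => i _; rewrite mpolyXn.
rewrite mcoeffX; case: eqP => [/mnmP/(_ (lshift n x))|]; last by rewrite mulr0.
rewrite mnm1E eqxx mnm_sumE big1 // => i _.
by rewrite mulmnE mnm1E eq_rlshift.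
Qed.

End Transition.

(* Main.v *)
Require Import Defs.
From HB Require Import structures.
From mathcomp Require Import all_boot all_order all_algebra.
From mathcomp Require Import mpoly ring.

(** In a model of LIRR the rationals embed, so rational polynomials can be
    evaluated and the atoms [FLep], [FEqp] mean what they say.  A state pair
    satisfying [F^t] is a chain of [t] steps of [F]; along the chain the linear
    invariants, hence all values of [Q[K]], stay constant.  Adding up the [t]
    inequalities [0 <= d (x_i - x_i+1) + q (a x_i)] telescopes the first summand
    and multiplies the second one by [t]. *)

Set Implicit Arguments.
Unset Strict Implicit.
Unset Printing Implicit Defensive.

Import Order.TTheory GRing.Theory Num.Theory.
Local Open Scope ring_scope.

(** * Ordered group structure of LIRR models *)

Lemma sle_subr (M : structure) (hM : LIRR M) (x y : M) :
  sle x y <-> sle 0 (y - x).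
Proof.
split=> [/(lirr_add hM (- x))|/(lirr_add hM x)]; first by rewrite subrr.
by rewrite add0r subrK.
Qed.

Lemma sle_add0 (M : structure) (hM : LIRR M) (x y : M) :
  sle 0 x -> sle 0 y -> sle 0 (x + y).
Proof.
move=> x0 y0; apply: (lirr_trans hM y0).
by have := lirr_add hM y x0; rewrite add0r.
Qed.

Lemma sle_mulrn (M : structure) (hM : LIRR M) (x : M) (k : nat) :
  sle 0 x -> sle 0 (x *+ k).
Proof.
move=> x0; elim: k => [|k IH]; first exact: lirr_refl.
by rewrite mulrS; apply: sle_add0.
Qed.

Lemma sint_natr (M : structure) (hM : LIRR M) (k : nat) : sint (k%:R : M).
Proof.
elim: k => [|k IH]; last by rewrite mulrS; apply: lirr_intD => //; apply: lirr_int1.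
rewrite mulr0n -(subrr 1); apply: lirr_intD => //; last apply: lirr_intN => //;
  exact: lirr_int1.
Qed.

(** Unperforation applied to both [x] and [- x], followed by antisymmetry, shows that a model has no
    torsion. *)
Lemma mulrn_eq0_LIRR (M : structure) (hM : LIRR M) (x : M) (k : nat) :
  (0 < k)%N -> x *+ k = 0 -> x = 0.
Proof.
move=> k0 xk; apply: (lirr_antisym hM); last first.
  by apply: (lirr_unperf hM k0); rewrite xk; apply: lirr_refl.
apply/(sle_subr hM); rewrite sub0r; apply: (lirr_unperf hM k0).
by rewrite mulNrn xk oppr0; apply: lirr_refl.
Qed.

Lemma mulrz_inj_LIRR (M : structure) (hM : LIRR M) (d : int) (x y : M) :
  d != 0 -> x *~ d = y *~ d -> x = y.
Proof.
move=> d0 /eqP; rewrite -subr_eq0 -mulrzBl => /eqP xyd.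
apply/eqP; rewrite -subr_eq0; apply/eqP.
apply: (mulrn_eq0_LIRR hM (k := `|d|%N)); first by rewrite absz_gt0.
case: d xyd {d0} => k; first by rewrite -pmulrn.
by rewrite NegzE mulrNz => /eqP; rewrite oppr_eq0 abszN => /eqP.
Qed.

(** * The embedding of the rationals *)

(** The boolean [==] makes the statement usable by [xchoose]. *)
Lemma natr_inv_exists (M : structure) (hM : LIRR M) (k : nat) :
  exists x : M, x *+ k.+1 == 1.
Proof. by have [x <-] := lirr_div hM (ltn0Sn k); exists x. Qed.

(** The chosen inverse of the denominator times the numerator. The predecessor matches the shift in
    [natr_inv_exists]; denominators are positive. *)
Definition rat_emb (M : structure) (hM : LIRR M) (q : rat) : M :=
  xchoose (natr_inv_exists hM `|denq q|.-1) *~ numq q.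

(** Frees [rat_emb] from reduced fractions: cross-multiply [numq q / denq q] with the given
    relation, then cancel [denq q] by torsion-freeness. The morphism laws follow by clearing
    denominators. *)
Lemma rat_emb_mulrz (M : structure) (hM : LIRR M) (q : rat) (d m : int) :
  q * d%:~R = m%:~R -> rat_emb hM q *~ d = m%:~R.
Proof.
move=> qd; apply: (mulrz_inj_LIRR hM (denq_neq0 q)).
have nd : numq q * d = m * denq q.
  by apply: (@intr_inj rat); rewrite !rmorphM /= -qd numqE mulrAC.
rewrite /rat_emb; move: (xchooseP (natr_inv_exists hM `|denq q|.-1)).
move: (xchoose _) => x /eqP; rewrite prednK ?absz_denq ?absz_gt0 ?denq_neq0 //.
rewrite pmulrn absz_denq => xd.
by rewrite -[_ *~ numq q *~ d]mulrzA nd [m * _]mulrC [x *~ _]mulrzA xd.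
Qed.

Lemma rat_emb_denq (M : structure) (hM : LIRR M) (q : rat) :
  rat_emb hM q *~ denq q = (numq q)%:~R.
Proof. by apply: rat_emb_mulrz; rewrite numqE. Qed.

Lemma rat_emb_is_zmod_morphism (M : structure) (hM : LIRR M) :
  zmod_morphism (rat_emb hM).
Proof.
move=> q r; apply: (@mulrz_inj_LIRR _ hM (denq q * denq r)).
  by rewrite mulf_neq0 ?denq_neq0.
rewrite (@rat_emb_mulrz _ _ _ _ (numq q * denq r - numq r * denq q)).
  rewrite mulrzBl [rat_emb hM q *~ _]mulrzA [denq q * _]mulrC.
  rewrite [rat_emb hM r *~ _]mulrzA !rat_emb_denq.
  by rewrite rmorphB /= !intrM !mulrzr.
by rewrite rmorphB !rmorphM /= !numqE; ring.
Qed.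

Lemma rat_emb_is_monoid_morphism (M : structure) (hM : LIRR M) :
  monoid_morphism (rat_emb hM).
Proof.
split=> [|q r].
  by have := @rat_emb_mulrz _ hM 1 1 1 (mulr1 _).
apply: (@mulrz_inj_LIRR _ hM (denq q * denq r)).
  by rewrite mulf_neq0 ?denq_neq0.
rewrite (@rat_emb_mulrz _ _ _ _ (numq q * numq r)); last first.
  by rewrite !rmorphM /= !numqE; ring.
by rewrite rmorphM /= -!rat_emb_denq mulrzA -mulrzAl -mulrzAr.
Qed.

HB.instance Definition _ (M : structure) (hM : LIRR M) :=
  GRing.isZmodMorphism.Build rat M (rat_emb hM) (rat_emb_is_zmod_morphism hM).
HB.instance Definition _ (M : structure) (hM : LIRR M) :=
  GRing.isMonoidMorphism.Build rat M (rat_emb hM)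
    (rat_emb_is_monoid_morphism hM).

(** * Evaluation of rational polynomials and of the atoms between them *)

Definition peval (M : structure) (hM : LIRR M) (k : nat) (e : 'I_k -> M) :
  {mpoly rat[k]} -> M := mmap (rat_emb hM) e.

HB.instance Definition _ (M : structure) (hM : LIRR M) (k : nat) (e : 'I_k -> M) :=
  GRing.RMorphism.on (peval hM e).

Lemma peval_eq (M : structure) (hM : LIRR M) (k : nat) (e e' : 'I_k -> M) p :
  e =1 e' -> peval hM e p = peval hM e' p.
Proof.
move=> ee'; apply: eq_bigr => m _; congr (_ * _).
by apply: eq_bigr => i _; rewrite ee'.
Qed.

Lemma pevalZ (M : structure) (hM : LIRR M) (k : nat) (e : 'I_k -> M) c p :
  peval hM e (c *: p) = rat_emb hM c * peval hM e p.
Proof. exact: mmapZ. Qed.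

Lemma pevalU (M : structure) (hM : LIRR M) (k : nat) (e : 'I_k -> M) i :
  peval hM e 'X_i = e i.
Proof. by rewrite /peval mmapX mmap1U. Qed.

(** The substitution lemma: every change of variables ([unprimed], [primed], [weaken], [delta],
    [delta_inv]) becomes a change of the evaluation point. *)
Lemma peval_subst (M : structure) (hM : LIRR M) (k l : nat) (e : 'I_l -> M)
    (h : 'I_k -> {mpoly rat[l]}) (p : {mpoly rat[k]}) :
  peval hM e (subst h p) = peval hM (fun i => peval hM e (h i)) p.
Proof.
rewrite /subst /comp_mpoly {1}/mmap raddf_sum; apply: eq_bigr => m _ /=.
rewrite rmorphM /= {1}/peval mmapC rmorph_prod; congr (_ * _).
by apply: eq_bigr => i _; rewrite rmorphXn /= tnth_mktuple.
Qed.

Lemma teval_tmonom (M : structure) (k : nat) (e : 'I_k -> M) (m : 'X_{1..k}) :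
  teval e (tmonom m) = mmap1 e m.
Proof.
rewrite /tmonom /mmap1 -big_enum /=.
elim: (enum 'I_k) => [|i s IH] /=; first by rewrite big_nil.
rewrite big_cons IH; congr (_ * _).
by elim: (m i : nat) => //= j ->; rewrite exprS.
Qed.

Lemma teval_signed_part (M : structure) (sg : int) (k : nat) (e : 'I_k -> M) p :
  teval e (signed_part sg p) =
  \sum_(m <- msupp p) mmap1 e m *+ absz (Num.max 0 (sg * cleared_coef p m)).
Proof.
rewrite /signed_part; elim: (msupp p : seq _) => [|m s IH] /=.
  by rewrite big_nil.
rewrite big_cons IH; congr (_ + _).
by elim: (absz _) => //= j ->; rewrite teval_tmonom mulrS.
Qed.

Lemma mulrz_pos_neg (U : zmodType) (x : U) (c : int) :
  x *+ absz (Num.max 0 (1 * c)) - x *+ absz (Num.max 0 (-1 * c)) = x *~ c.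
Proof.
rewrite mul1r mulN1r; case: c => j.
  rewrite (max_r _) // (max_l _) ?oppr_le0 // mulr0n subr0 absz_nat.
  by rewrite -pmulrn.
rewrite NegzE opprK (max_l _) ?oppr_le0 // (max_r _) // mulr0n sub0r.
by rewrite mulrNz absz_nat.
Qed.

Definition common_denom (k : nat) (p : {mpoly rat[k]}) : int :=
  \prod_(m <- msupp p) denq p@_m.

Lemma common_denom_gt0 (k : nat) (p : {mpoly rat[k]}) : 0 < common_denom p.
Proof. by apply: prodr_gt0 => m _; apply: denq_gt0. Qed.

(** Taking [numq] loses nothing, because [denq p@_m] is one factor of the common denominator and so
    the product is an integer. *)
Lemma cleared_coefE (k : nat) (p : {mpoly rat[k]}) (m : 'X_{1..k}) :
  m \in msupp p ->
  (cleared_coef p m)%:~R = (common_denom p)%:~R * p@_m :> rat.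
Proof.
move=> mp; rewrite /cleared_coef -/(common_denom p).
have -> : (common_denom p)%:~R * p@_m =
    ((\prod_(m' <- rem m (msupp p)) denq p@_m') * numq p@_m)%:~R.
  by rewrite /common_denom (big_rem m mp) /= !intrM numqE; ring.
by rewrite numq_int.
Qed.

Lemma teval_signed_partB (M : structure) (hM : LIRR M) (k : nat) (e : 'I_k -> M)
    (p : {mpoly rat[k]}) :
  teval e (signed_part 1 p) - teval e (signed_part (-1) p) =
  peval hM e p *~ common_denom p.
Proof.
rewrite !teval_signed_part -sumrB -mulrzr /peval /mmap mulr_suml !big_seq.
apply: eq_bigr => m mp; rewrite mulrz_pos_neg -mulrzl.
(* The integer coefficient is read as the image of a rational, where it factors as the common
   denominator times [p@_m]. *)
rewrite -(rmorph_int (rat_emb hM)) cleared_coefE // rmorphM /= rmorph_int.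
by rewrite -mulrA mulrC.
Qed.

(** The two sides of the atom differ by a positive multiple of the value of [q - p]; unperforation
    cancels the multiple and additivity restores it. *)
Lemma sat_FLep (M : structure) (hM : LIRR M) (k : nat) (e : 'I_k -> M) p q :
  sat e (FLep p q) <-> sle (peval hM e p) (peval hM e q).
Proof.
rewrite /= (sle_subr hM) (teval_signed_partB hM) rmorphB /=.
rewrite [X in _ <-> X](sle_subr hM).
case: (common_denom _) (common_denom_gt0 (q - p)) => // j j0.
by rewrite -pmulrn; split; [apply: lirr_unperf | apply: sle_mulrn].
Qed.

Lemma sat_FEqp (M : structure) (hM : LIRR M) (k : nat) (e : 'I_k -> M) p q :
  sat e (FEqp p q) <-> peval hM e p = peval hM e q.
Proof.
have d0 : common_denom (q - p) != 0 by rewrite gt_eqF ?common_denom_gt0.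
have := teval_signed_partB hM e (q - p); rewrite rmorphB /= => E; split=> pq.
  apply/esym/eqP; rewrite -subr_eq0; apply/eqP.
  by apply: (mulrz_inj_LIRR hM d0); rewrite -E pq subrr mul0rz.
by apply/esym/eqP; rewrite -subr_eq0 E pq subrr mul0rz.
Qed.

(** * Satisfaction of renamings, conjunctions and compositions *)

Lemma teval_trename (M : structure) (k l : nat) (f : 'I_k -> 'I_l)
    (e : 'I_l -> M) (e' : 'I_k -> M) (s : term k) :
  e \o f =1 e' -> teval e (trename f s) = teval e' s.
Proof. by move=> ee'; elim: s => //= s -> u ->. Qed.

Lemma econs_under_binder (T : Type) (k l : nat) (f : 'I_k -> 'I_l)
    (e : 'I_l -> T) (e' : 'I_k -> T) (x : T) :
  e \o f =1 e' -> econs x e \o under_binder f =1 econs x e'.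
Proof.
move=> ee' i; rewrite /= /econs /under_binder.
by case: (unliftP ord0 i) => [j _|_]; rewrite ?liftK ?unlift_none; first exact: ee'.
Qed.

(** Environments are compared pointwise, and the induction generalizes over the renaming, since each
    quantifier replaces it by [under_binder f]. *)
Lemma sat_frename (M : structure) (k l : nat) (f : 'I_k -> 'I_l)
    (e : 'I_l -> M) (e' : 'I_k -> M) (F : formula k) :
  e \o f =1 e' -> sat e (frename f F) <-> sat e' F.
Proof.
elim: F l f e e' => {k} //=.
- by move=> k s u l f e e' ee'; rewrite !(teval_trename _ ee').
- by move=> k s u l f e e' ee'; rewrite !(teval_trename _ ee').
- by move=> k s l f e e' ee'; rewrite !(teval_trename _ ee').
- by move=> k G IH l f e e' ee'; rewrite (IH _ _ _ _ ee').
- by move=> k G IHG H IHH l f e e' ee'; rewrite (IHG _ _ _ _ ee') (IHH _ _ _ _ ee').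
- by move=> k G IHG H IHH l f e e' ee'; rewrite (IHG _ _ _ _ ee') (IHH _ _ _ _ ee').
- move=> k G IH l f e e' ee'.
  by split=> -[x xG]; exists x; apply/(IH _ _ _ _ (econs_under_binder x ee')).
- move=> k G IH l f e e' ee'.
  by split=> xG x; apply/(IH _ _ _ _ (econs_under_binder x ee')).
Qed.

Lemma sat_FAnds_map (M : structure) (k : nat) (e : 'I_k -> M) (I : eqType)
    (G : I -> formula k) (s : seq I) :
  sat e (FAnds [seq G i | i <- s]) <-> forall i, i \in s -> sat e (G i).
Proof.
elim: s => [|j s IH] /=; first by split.
split=> [[Gj /IH Gs] i|Gs].
  by rewrite inE => /predU1P[->|/Gs].
split; first by apply: Gs; rewrite mem_head.
by apply/IH => i si; apply: Gs; rewrite inE si orbT.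
Qed.

Lemma econs_rshift (T : Type) (k : nat) (x : T) (e : 'I_k -> T) (i : 'I_k) :
  econs x e (rshift 1 i) = e i.
Proof.
have -> : rshift 1 i = lift ord0 i by apply: val_inj.
by rewrite /econs liftK.
Qed.

Lemma econs_tcst (T : Type) (N : nat) (x : T) (e : 'I_(N + N) -> T) :
  econs x e (tcst N) = x.
Proof.
have -> : tcst N = ord0 by apply: val_inj.
by rewrite /econs unlift_none.
Qed.

Lemma sat_FExs (M : structure) (m k : nat) (e : 'I_k -> M)
    (F : formula (m + k)) :
  sat e (FExs F) -> exists2 e', e' \o @rshift m k =1 e & sat e' F.
Proof.
elim: m F => [|m IH] F /=.
  by exists e => // i /=; congr e; apply: val_inj.
case/IH=> e' e'e [x xF]; exists (econs x e') => // i /=.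
have -> : rshift m.+1 i = rshift 1 (rshift m i) by apply: val_inj.
by rewrite econs_rshift -e'e.
Qed.

Lemma case_split_lshift (T : Type) (m k : nat) (f : 'I_m -> T) (g : 'I_k -> T) i :
  case_split f g (lshift k i) = f i.
Proof. by rewrite /case_split (unsplitK (inl i)). Qed.

Lemma case_split_rshift (T : Type) (m k : nat) (f : 'I_m -> T) (g : 'I_k -> T) i :
  case_split f g (rshift m i) = g i.
Proof. by rewrite /case_split (unsplitK (inr i)). Qed.

Lemma sat_fcomp (M : structure) (N : nat) (F G : formula (N + N))
    (e : 'I_(N + N) -> M) :
  sat e (fcomp F G) -> exists e1 e2,
    [/\ sat e1 F, sat e2 G, e1 \o lshift N =1 e \o lshift N,
        e1 \o @rshift N N =1 e2 \o lshift N
      & e2 \o @rshift N N =1 e \o @rshift N N].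
Proof.
case/sat_FExs=> e' e'e [/(sat_frename _ (frefl _)) sF /(sat_frename _ (frefl _)) sG].
(* Both witnesses are [e'] precomposed with the renamings of [fcomp]; the intermediate state
   consists of the values that [e'] gives to the bound constants. *)
do 2![eexists]; split; [exact: sF | exact: sG | ..] => x /=;
  by rewrite ?case_split_lshift ?case_split_rshift // -e'e.
Qed.

(** * Acceleration *)

Lemma peval_unprimed (M : structure) (hM : LIRR M) (N : nat)
    (e : 'I_(N + N) -> M) (p : {mpoly rat[N]}) :
  peval hM e (unprimed p) = peval hM (e \o lshift N) p.
Proof. by rewrite peval_subst; apply: peval_eq => x; rewrite pevalU. Qed.

Lemma peval_primed (M : structure) (hM : LIRR M) (N : nat)
    (e : 'I_(N + N) -> M) (p : {mpoly rat[N]}) :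
  peval hM e (primed p) = peval hM (e \o @rshift N N) p.
Proof. by rewrite peval_subst; apply: peval_eq => x; rewrite pevalU. Qed.

Lemma peval_weaken (M : structure) (hM : LIRR M) (N : nat) (x : M)
    (e : 'I_(N + N) -> M) (p : {mpoly rat[N + N]}) :
  peval hM (econs x e) (weaken p) = peval hM e p.
Proof.
by rewrite peval_subst; apply: peval_eq => i; rewrite pevalU econs_rshift.
Qed.

Lemma peval_delta_piD (M : structure) (hM : LIRR M) (N n : nat)
    (e : 'I_(N + N) -> M) (p : {mpoly rat[N + n]}) :
  peval hM e (delta (piD p)) =
  \sum_(x < N) rat_emb hM p@_(U_(lshift n x)) * (e (lshift N x) - e (rshift N x)).
Proof.
rewrite peval_subst /piD raddf_sum; apply: eq_bigr => x _ /=.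
by rewrite pevalZ pevalU rmorphB /= !pevalU.
Qed.

Lemma peval_cf (M : structure) (hM : LIRR M) (N n : nat)
    (a : 'I_n -> {mpoly rat[N]}) (x : M) (e : 'I_(N + N) -> M) p :
  peval hM (econs x e) (cf a p) =
  peval hM e (delta (piD p)) + x * peval hM e (unprimed (Defs.inv a (piK p))).
Proof.
rewrite rmorphD rmorphM /= !peval_weaken pevalU.
by rewrite econs_tcst.
Qed.

(** Membership in the span matters: only there are [piD p] and [piK p] the two summands of [p]. *)
Lemma peval_delta_inv (M : structure) (hM : LIRR M) (N n : nat)
    (a : 'I_n -> {mpoly rat[N]}) (e : 'I_(N + N) -> M) p :
  spanD_plus_QK p ->
  peval hM e (delta_inv a p) =
  peval hM e (delta (piD p)) + peval hM e (unprimed (Defs.inv a (piK p))).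
Proof.
case=> d [q [hd ->]]; have [-> ->] := piDK_unique q hd.
rewrite peval_unprimed !peval_subst rmorphD /= !peval_subst.
congr (_ + _); apply: peval_eq => i; rewrite pevalU.
  by rewrite case_split_lshift.
by rewrite case_split_rshift peval_unprimed.
Qed.

Lemma cone_generator (N n : nat) (V : seq {mpoly rat[n]})
    (R : seq {mpoly rat[N + n]}) r :
  r \in R -> ideal_plus_cone V R r.
Proof.
(* [R] may list [r] several times, so its weight is shared between the copies. *)
move=> rR; exists (fun=> 0), (fun r' => if r' == r then (count_mem r R)%:R^-1 else 0).
split=> [r' _|]; first by case: ifP => // _; rewrite invr_ge0 ler0n.
rewrite big1 => [|v _]; last by rewrite mul0r.
rewrite /inK /subst rmorph0 add0r.
transitivity (\sum_(r' <- R | r' == r) (count_mem r R)%:R^-1 *: r).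
  rewrite big_const_seq iter_addr_0 -scaler_nat scalerA mulfV ?scale1r //.
  by rewrite pnatr_eq0 -lt0n -has_count has_pred1.
rewrite big_mkcond; apply: eq_bigr => r' _.
by case: eqP => [->|_]; rewrite ?scale0r.
Qed.

Lemma linear_form0 (N : nat) : linear_form (0 : {mpoly rat[N]}).
Proof. by exists (fun=> 0); rewrite big1 // => x _; rewrite scale0r. Qed.

Lemma piDK_inK (N n : nat) (v : {mpoly rat[n]}) :
  piD (inK N v) = 0 /\ piK (inK N v) = v.
Proof.
by have := piDK_unique v (linear_form0 N); rewrite /inD /subst rmorph0 add0r.
Qed.

Section Accelerated.

Variables (M : structure) (hM : LIRR M) (N n : nat).
Variables (a : 'I_n -> {mpoly rat[N]}).
Variables (V : seq {mpoly rat[n]}) (R : seq {mpoly rat[N + n]}).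

(** The induction invariant: the constraints of [fexp] with [k] for the fresh constant, together
    with preservation of each [a i], which makes the property stable under composition. *)
Definition accelerated (k : nat) (e : 'I_(N + N) -> M) : Prop :=
  [/\ forall i, peval hM e (primed (a i)) = peval hM e (unprimed (a i)),
      forall v, v \in V -> peval hM e (unprimed (Defs.inv a v)) *+ k = 0
    & forall r, r \in R ->
        sle 0 (peval hM e (delta (piD r))
               + peval hM e (unprimed (Defs.inv a (piK r))) *+ k)].

Lemma accelerated_id (e : 'I_(N + N) -> M) :
  (forall x, e (rshift N x) = e (lshift N x)) -> accelerated 0 e.
Proof.
move=> ee; split=> [i|v _|r _]; last 2 first.
- by rewrite mulr0n.
- rewrite mulr0n addr0 peval_delta_piD big1 => [|x _]; first exact: lirr_refl.
  by rewrite ee subrr mulr0.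
- by rewrite peval_primed peval_unprimed; apply: peval_eq.
Qed.

Lemma accelerated_comp (k l : nat) (e1 e2 e : 'I_(N + N) -> M) :
  e1 \o lshift N =1 e \o lshift N ->
  e1 \o @rshift N N =1 e2 \o lshift N ->
  e2 \o @rshift N N =1 e \o @rshift N N ->
  accelerated k e1 -> accelerated l e2 -> accelerated (k + l) e.
Proof.
move=> e1e e12 e2e [a1 V1 R1] [a2 V2 R2].
(* Polynomials in the invariants agree at all three initial states: [e1] starts where [e] does, and
   [e2] starts where [e1] ends, where each [a i] is unchanged. *)
have invK (q : {mpoly rat[n]}) :
    peval hM e1 (unprimed (Defs.inv a q)) = peval hM e (unprimed (Defs.inv a q)) /\
    peval hM e2 (unprimed (Defs.inv a q)) = peval hM e (unprimed (Defs.inv a q)).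
  split; rewrite !peval_unprimed ?(peval_eq _ _ e1e) // !peval_subst.
  apply: peval_eq => i; rewrite -(peval_eq _ _ e12) -(peval_eq _ _ e1e).
  by rewrite -peval_primed a1 peval_unprimed.
split=> [i|v vV|r rR].
- rewrite peval_primed -(peval_eq _ _ e2e) -peval_primed a2 peval_unprimed.
  rewrite -(peval_eq _ _ e12) -peval_primed a1 !peval_unprimed.
  exact: peval_eq.
- have [<- E] := invK v; rewrite mulrnDr V1 // add0r.
  by have [-> <-] := invK v; rewrite V2.
(* In the sum of the two inequalities the differences telescope through the intermediate state,
   while the equal invariant values add up to multiplicity [k + l]. *)
have := sle_add0 hM (R1 r rR) (R2 r rR).
have [-> ->] := invK (piK r).
rewrite addrACA -mulrnDr !peval_delta_piD -big_split /=.
congr sle; congr (_ + _); apply: eq_bigr => x _; rewrite -mulrDr; congr (_ * _).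
have /= := e1e x; have /= := e12 x; have /= := e2e x => -> -> ->.
by rewrite addrA subrK.
Qed.

Lemma accelerated_fpow (F : formula (N + N)) (t : nat) (e : 'I_(N + N) -> M) :
  (forall e', sat e' F -> accelerated 1 e') ->
  sat e (fpow F t) -> accelerated t e.
Proof.
(* [iterop] gives [fid] at 0 and [F] itself at 1, so the induction starts at one step and each
   further step is put in front. *)
move=> F1; case: t => [|t] /=.
  by move/sat_FAnds_map=> ee; apply: accelerated_id => x; apply: ee; rewrite mem_enum.
elim: t e => [|t IH] e; first exact: F1.
case/sat_fcomp=> e1 [e2 [/F1 A1 /IH A2 e1e e12 e2e]].
by rewrite -add1n; apply: accelerated_comp A1 A2.
Qed.

Lemma sat_fstar_accelerated (t : nat) (e : 'I_(N + N) -> M) :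
  accelerated t e -> sat e (fstar a V R).
Proof.
(* The number of steps, read in the model, is the witness for the fresh constant. *)
case=> _ hV hR; exists t%:R => /=.
rewrite econs_tcst.
split; first exact: sint_natr.
split; first by apply: sle_mulrn => //; apply: lirr_01.
split; apply/sat_FAnds_map.
  move=> v vV; apply/(sat_FEqp hM); rewrite rmorph0 peval_cf mulr_natl.
  have [-> ->] := piDK_inK N v.
  by rewrite /delta /subst !rmorph0 add0r hV.
move=> r rR; apply/(sat_FLep hM); rewrite rmorph0 peval_cf mulr_natl.
exact: hR.
Qed.

End Accelerated.

Theorem theorem5p2 (N : nat) (F : formula (N + N)) (hF : ground F)
    (n : nat) (a : 'I_n -> {mpoly rat[N]}) (ha : is_basis (LinInv F) a)
    (V : seq {mpoly rat[n]}) (R : seq {mpoly rat[N + n]})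
    (hR : forall r, r \in R -> spanD_plus_QK r)
    (hVR : forall p : {mpoly rat[N + n]},
      ideal_plus_cone V R p <-> Cn F (delta_inv a p) /\ spanD_plus_QK p)
    (hV : forall v, v \in V -> entails F (FEqp (delta_inv a (inK N v)) 0%R))
    (t : nat) :
  entails (fpow F t) (fstar a V R).
Proof.
move=> M hM e eF; apply: (sat_fstar_accelerated (hM := hM)).
(* It remains to treat one step of [F]: the clauses come from the basis of invariants, from the
   equations for [V], and from the consequences [R]. *)
apply: accelerated_fpow eF => {}e eF; split=> [i|v vV|r rR].
- by case: ha => /(_ i)[_ /(_ M hM e eF)/(sat_FEqp hM)].
- have linK : spanD_plus_QK (inK N v).
    exists 0, v; split; first exact: linear_form0.
    by rewrite /inD /subst rmorph0 add0r.
  have := hV v vV M hM e eF => /(sat_FEqp hM).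
  rewrite peval_delta_inv // !rmorph0 mulr1n; have [-> ->] := piDK_inK N v.
  by rewrite /delta /subst !rmorph0 add0r.
(* Each [r] lies in the cone that it helps to generate, so its image under [delta_inv] is a
   consequence of [F]. *)
have [/(_ M hM e eF)/(sat_FLep hM) + _] := (hVR r).1 (cone_generator V rR).
by rewrite rmorph0 mulr1n peval_delta_inv //; apply: hR.
Qed.
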